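(* Let $(K,d)$ be a nonempty compact metric space and let $(\Phi,\|\cdot\|_\Phi)$ be a Banach space of functions included in $C(K)$ (the space of real-valued continuous functions on $K$) which separates the points of $K$ and such that $\alpha\|\varphi\|_\Phi\geq\|\varphi\|_\infty$ for all $\varphi\in\Phi$, for some real number $\alpha>0$. For each $x\in K$, let $$\Omega_x:=\{f\in\Phi\mathcal{C}(K):\ f(x)=\max_K f\}.$$ Then, for each $x\in K$, $\Omega_x$ is a nonempty closed cone in $(\Phi\mathcal{C}(K),\rho_\infty)$ and there exists $e\in\Phi\mathrm{Ext}(K)$ such that $\Omega_x\subset\Omega_e$.
   Context: $\|\cdot\|_\infty$ is the sup-norm on $C(K)$. $\Phi$-between: for $a,x,y\in K$, $a$ is $\Phi$-between $x$ and $y$ if for every $\varphi\in\Phi$, $\varphi(x)\le\varphi(a)$ and $\varphi(y)\le\varphi(a)$ imply $\varphi(a)=\varphi(x)=\varphi(y)$. $\Phi$-extremal points: a point $a\in K$ is $\Phi$-extremal in $K$ if whenever $x,y\in K$ and $a$ is $\Phi$-between $x$ and $y$, then $x=a=y$. The set of $\Phi$-extremal points of $K$ is $\Phi\mathrm{Ext}(K)$. $\Phi$-convex functions: $f:K\to\mathbb{R}$ is $\Phi$-convex if for all $a,x,y\in K$ such that $a$ is $\Phi$-between $x$ and $y$, $f(x)\le f(a)$ and $f(y)\le f(a)$ imply $f(x)=f(a)=f(y)$. $\Phi\mathcal{C}(K)$ is the set of all real-valued $\Phi$-convex upper semi-continuous functions on $K$, equipped with the metric $$\rho_\infty(f,g):=\sup_{x\in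 K}\frac{|f(x)-g(x)|}{1+|f(x)-g(x)|}.$$ A cone is a set of functions stable under multiplication by positive scalars. *)

(* Defs.v *)
From HB Require Import structures.
From mathcomp Require Import all_boot all_order all_algebra.
From mathcomp Require Import all_classical all_reals all_analysis.
From mathcomp Require Import ring lra.

Set Implicit Arguments.
Unset Strict Implicit.
Unset Printing Implicit Defensive.

Import Order.TTheory GRing.Theory Num.Theory.
Import numFieldNormedType.Exports.

Local Open Scope classical_set_scope.
Local Open Scope ring_scope.

Section phi_convexity.
Context {R : realType} {K : topologicalType}.
Implicit Types (Phi : set (K -> R)) (f g phi : K -> R) (a x y : K).

(* Only meaningful for bounded [f]: [sup] of an unbounded set is [0]. *)
Definition sup_norm f : R := sup (range (fun x => `|f x|)).

Definition separates_points Phi : Prop :=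
  forall x y, x != y -> exists2 phi, Phi phi & phi x != phi y.

Definition between Phi a x y : Prop :=
  forall phi, Phi phi -> phi x <= phi a -> phi y <= phi a ->
    phi a = phi x /\ phi x = phi y.

Definition extremal Phi : set K :=
  [set a | forall x y, between Phi a x y -> x = a /\ a = y].

Definition convex_fun Phi f : Prop :=
  forall a x y, between Phi a x y -> f x <= f a -> f y <= f a ->
    f x = f a /\ f a = f y.

Definition upper_semicontinuous f : Prop :=
  forall x b, f x < b -> \forall y \near x, f y < b.

Lemma upper_semicontinuousN f :
  upper_semicontinuous f <-> lower_semicontinuous (fun x => (- f x)%:E).
Proof.
split=> H x b.
  rewrite lte_fin ltrNr => /H Hx; exists [set y | f y < - b] => // y.
  by rewrite /= lte_fin ltrNr.
rewrite -ltrN2 -lte_fin => /H [V Vx VH].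
by apply: filterS Vx => y /VH; rewrite lte_fin ltrN2.
Qed.

Definition convex_usc Phi : set (K -> R) :=
  [set f | convex_fun Phi f /\ upper_semicontinuous f].

Definition rho_infty f g : R :=
  sup (range (fun x => `|f x - g x| / (1 + `|f x - g x|))).

Definition cone (C : set (K -> R)) : Prop :=
  forall (c : R) f, 0 < c -> C f -> C (fun x => c * f x).

(* [f x = max_K f] is spelled out: the value [f x] bounds [f] above. *)
Definition Omega Phi x : set (K -> R) :=
  [set f | convex_usc Phi f /\ forall y, f y <= f x].

Lemma rho_infty_has_sup f g (x : K) :
  has_sup (range (fun x => `|f x - g x| / (1 + `|f x - g x|))).
Proof.
split; first by exists (`|f x - g x| / (1 + `|f x - g x|)), x.
exists 1 => _ [y _ <-].
have h := normr_ge0 (f y - g y).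
by rewrite ler_pdivrMr; lra.
Qed.

Lemma rho_infty_ub f g x :
  `|f x - g x| / (1 + `|f x - g x|) <= rho_infty f g.
Proof.
have [_ ub] := rho_infty_has_sup f g x.
by apply: ub_le_sup => //; exists x.
Qed.

Lemma rho_infty_le f g (M : R) : 0 <= M ->
  (forall x, `|f x - g x| / (1 + `|f x - g x|) <= M) -> rho_infty f g <= M.
Proof.
move=> M0 H; rewrite /rho_infty.
have [[z _]|/set0P/negP/negPn/eqP ->] := pselect ([set: K] !=set0); last first.
  by rewrite image_set0 sup0.
apply: ge_sup; first by exists (`|f z - g z| / (1 + `|f z - g z|)), z.
by move=> _ [y _ <-].
Qed.

Lemma rho_infty_ge0 f g : 0 <= rho_infty f g.
Proof.
have [[z _]|/set0P/negP/negPn/eqP E] := pselect ([set: K] !=set0); last first.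
  by rewrite /rho_infty E image_set0 sup0.
apply: le_trans (rho_infty_ub f g z).
by rewrite divr_ge0 ?addr_ge0.
Qed.

Lemma rho_inftyxx f : rho_infty f f = 0.
Proof.
apply/eqP; rewrite eq_le rho_infty_ge0 andbT.
by apply: (rho_infty_le (lexx 0)) => x; rewrite subrr normr0 mul0r.
Qed.

Lemma rho_infty_eq0 f g : rho_infty f g = 0 -> f = g.
Proof.
move=> fg0; apply/funext => x.
have := rho_infty_ub f g x; rewrite fg0 => h.
apply/eqP; rewrite -subr_eq0 -normr_le0.
have h0 := normr_ge0 (f x - g x).
by move: h; rewrite ler_pdivrMr ?mul0r//; lra.
Qed.

Lemma rho_infty_sym f g : rho_infty f g = rho_infty g f.
Proof.
by rewrite /rho_infty; congr (sup _); apply: eq_imagel => x _; rewrite distrC.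
Qed.

Lemma rho_infty_triangle g f h :
  rho_infty f h <= rho_infty f g + rho_infty g h.
Proof.
have H0 : 0 <= rho_infty f g + rho_infty g h.
  by apply: addr_ge0; apply: rho_infty_ge0.
apply: (rho_infty_le H0) => x.
apply: le_trans (lerD (rho_infty_ub f g x) (rho_infty_ub g h x)).
have := ler_distD (g x) (f x) (h x).
move: (normr_ge0 (f x - g x)) (normr_ge0 (g x - h x)) (normr_ge0 (f x - h x)).
move: `|f x - g x| `|g x - h x| `|f x - h x| => s t u s0 t0 u0 ust.
have us (v : R) : 0 <= v -> v / (1 + v) = 1 - (1 + v)^-1.
  by move=> v0; field; lra.
rewrite !us//.
have -> : 1 - (1 + s)^-1 + (1 - (1 + t)^-1) =
   1 - (1 + (s + t))^-1 + (s * t * (2 + s + t)) / ((1 + s) * (1 + t) * (1 + (s + t))).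
  by field; rewrite ?mulf_neq0//; lra.
apply: (@le_trans _ _ (1 - (1 + (s + t))^-1)).
  by rewrite lerD2l lerN2 lef_pV2 ?posrE; lra.
by rewrite lerDl divr_ge0 ?mulr_ge0//; lra.
Qed.

End phi_convexity.

(* The set [convex_usc Phi] as a metric space. A separate constant, since
   [set_type] of a set of functions carries other topologies. *)
Definition convex_usc_space {R : realType} {K : topologicalType}
  (Phi : set (K -> R)) : Type := set_type (convex_usc Phi).

Section convex_usc_space.
Context {R : realType} {K : topologicalType} (Phi : set (K -> R)).
Local Notation PhiC := (convex_usc_space Phi).

Definition convex_usc_fun (f : PhiC) : K -> R := set_val f.

Let dist (f g : PhiC) : R := rho_infty (convex_usc_fun f) (convex_usc_fun g).

Let distxx f : dist f f = 0. Proof. exact: rho_inftyxx. Qed.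

Let dist_positivity f g : dist f g = 0 -> f = g.
Proof. by move=> /rho_infty_eq0 /val_inj. Qed.

Let dist_sym f g : dist f g = dist g f. Proof. exact: rho_infty_sym. Qed.

Let dist_triangle g f h : dist f h <= dist f g + dist g h.
Proof. exact: rho_infty_triangle. Qed.

HB.instance Definition _ := Choice.copy PhiC (set_type (convex_usc Phi)).
HB.instance Definition _ := @isMetric.Build R PhiC
  dist distxx dist_positivity dist_sym dist_triangle.

Lemma convex_usc_mdistE (f g : PhiC) :
  mdist f g = rho_infty (convex_usc_fun f) (convex_usc_fun g).
Proof. by []. Qed.

End convex_usc_space.

(* Main.v *)
Require Import Defs.
From mathcomp Require Import all_boot all_order all_algebra.
From mathcomp Require Import all_classical all_reals all_analysis.
From mathcomp Require Import lra.

Set Implicit Arguments.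
Unset Strict Implicit.
Unset Printing Implicit Defensive.

Import Order.TTheory GRing.Theory Num.Theory.
Import numFieldNormedType.Exports.

Local Open Scope classical_set_scope.
Local Open Scope ring_scope.

(** The inclusion [Omega Phi x `<=` Omega Phi e] is a form of Bauer's maximum
    principle, and the argument is the one behind the Krein-Milman theorem.
    Call a set [A] a face if the two ends of any betweenness whose middle point
    is in [A] are in [A] too. The points of a face at which a [Phi]-convex
    function attains its maximum over that face form a face again
    ([face_argmax]), closed if the first face is closed and the function is
    upper semicontinuous. So the points at which every [f] in
    [Omega Phi x] is maximal form a closed face, and it contains [x]. It
    remains to see that a nonempty closed face [A] of a compact space contains
    an extremal point ([closed_face_extremal]). By compactness and Zorn's lemma
    [A] contains a minimal nonempty closed face ([minimal_closed_face]). On that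
    face each [phi] in [Phi] attains a maximum, and it does so on a closed
    subface, which by minimality is everything: [phi] is constant there. As
    [Phi] separates points, the minimal face is a single point, and a face
    reduced to a point consists of an extremal point.

    The set [Omega Phi x] contains the constants, and it is closed because two
    functions at small distance for [rho_infty] are uniformly close. *)

Section faces.
Context {R : realType} {K : topologicalType} (Phi : set (K -> R)).
Implicit Types (A B : set K) (f phi : K -> R).

Definition face A := forall a x y, A a -> between Phi a x y -> A x /\ A y.

Definition closed_face A := [/\ A !=set0, closed A & face A].

Lemma face_bigcap (I : Type) (D : set I) (A : I -> set K) :
  (forall j, D j -> face (A j)) -> face (\bigcap_(j in D) A j).
Proof.
by move=> fA a x y Aa axy; split=> j Dj; case: (fA j Dj a x y (Aa j Dj) axy).
Qed.

(** If [f] is maximal at the middle point of a betweenness inside [A], then it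
    does not exceed that value at the ends, so convexity forces equality. *)
Lemma face_argmax A f m : face A -> convex_fun Phi f ->
  (forall a, A a -> f a <= f m) -> face (A `&` [set a | f m <= f a]).
Proof.
move=> fA cf fm a x y [Aa /= ma] axy.
have [Ax Ay] := fA _ _ _ Aa axy.
have [fxa fay] := cf a x y axy (le_trans (fm _ Ax) ma) (le_trans (fm _ Ay) ma).
by split; split => //=; rewrite ?fxa // -fay.
Qed.

Lemma usc_closed_superlevel f r :
  upper_semicontinuous f -> closed [set a | r <= f a].
Proof.
move=> uf; rewrite -openC openE => a /= /negP; rewrite -ltNge => /uf.
by apply: filterS => b fb /=; rewrite leNgt fb.
Qed.

Lemma continuous_convex_usc phi :
  Phi phi -> continuous phi -> convex_usc Phi phi.
Proof.
move=> Pphi cphi; split=> [a x y axy xa ya|a b ab].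
  by have [-> ->] := axy phi Pphi xa ya.
exact: (cphi a _ (lt_nbhsl ab)).
Qed.

(** Compactness makes the intersection of a chain of nonempty closed faces
    nonempty. Zorn's lemma is stated for unions, hence the passage to
    complements relative to [A]. *)
Lemma minimal_closed_face A : compact [set: K] -> closed_face A ->
  exists B, [/\ B `<=` A, closed_face B &
    forall C, closed_face C -> C `<=` B -> C = B].
Proof.
move=> cK [A0 clA fA].
have [F FP chainF|U [cU Umax]] :=
  @Zorn_bigcup _ (fun U => closed_face (A `\` U)).
  have [[U0 FU0]|F0] := pselect (F !=set0); last first.
    suff -> : \bigcup_(X in F) X = set0 by rewrite setD0.
    by apply/seteqP; split=> // p [U FU]; case: F0; exists U.
  have -> : A `\` \bigcup_(U in F) U = \bigcap_(U in F) (A `\` U).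
    apply/seteqP; split=> [p [Ap nUp] U FU|p Hp].
      by split=> // Up; apply: nUp; exists U.
    by split=> [|[U FU Up]]; [case: (Hp _ FU0) | case: (Hp _ FU)].
  split.
  - pose G := filter_from F (fun U => A `\` U).
    have GF : ProperFilter G.
      apply: filter_from_proper => [|U FU]; last by case: (FP _ FU).
      apply: filter_from_filter; first by exists U0.
      move=> U W FU FW.
      have [UW|WU] := chainF _ _ FU FW; [exists W|exists U] => //.
        by move=> p [Ap nWp]; split; split=> // /UW.
      by move=> p [Ap nUp]; split; split=> // /WU.
    have [|p [_ Gp]] := cK G GF; first exact: filterT.
    exists p => U FU; have [_ clU _] := FP _ FU.
    by apply: clU => W /Gp; apply; exists U.
  - by apply: closed_bigI => U /FP[].
  - by apply: face_bigcap => U /FP[].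
exists (A `\` U); split=> // C cC CAU; apply/seteqP; split=> // p [Ap nUp].
apply: contrapT => nCp; apply: (Umax (~` C)).
  by split=> [q Uq /CAU[]//|sub]; apply: nUp; exact: sub.
rewrite setDE setCK (_ : A `&` C = C) //.
by apply/setIidPr => q /CAU [].
Qed.

Lemma closed_face_extremal A : compact [set: K] ->
  (forall phi, Phi phi -> continuous phi) -> separates_points Phi ->
  closed_face A -> exists2 e, A e & extremal Phi e.
Proof.
move=> cK cPhi sepPhi /(minimal_closed_face cK)[B [BA [[e Be] clB fB] Bmin]].
have phi_cst phi p q : Phi phi -> B p -> B q -> phi p <= phi q.
  move=> Pphi Bp Bq; have cphi := cPhi _ Pphi.
  have cB : compact B by exact: (subclosed_compact clB cK).
  have [||m /set_mem Bm mmax] := @compact_EVT_max K R phi B _ cB.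
  - by exists e.
  - exact: continuous_subspaceT.
  have {}mmax b : B b -> phi b <= phi m by move=> ?; apply/mmax/mem_set.
  have [cvx usc] := continuous_convex_usc Pphi cphi.
  have BE : B `&` [set b | phi m <= phi b] = B.
    apply: Bmin; last by move=> ? [].
    split; first by exists m; split=> /=.
    - by apply: closedI => //; exact: usc_closed_superlevel.
    - exact: face_argmax.
  by have := Bq; rewrite -BE => -[_ /=]; apply: le_trans; exact: mmax.
have B1 p : B p -> p = e.
  move=> Bp; apply: contrapT => /eqP /sepPhi[phi Pphi] /negP; apply.
  by rewrite eq_le !phi_cst.
exists e; first exact: BA.
by move=> x y exy; have [/B1 -> /B1 ->] := fB e x y Be exy.
Qed.

End faces.

Section Omega.
Context {R : realType} {K : topologicalType} (Phi : set (K -> R)).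
Implicit Types (f g : K -> R) (x : K).

Lemma Omega_cst x : Omega Phi x (fun=> 0).
Proof. by split=> //; split=> // z b b0; exact: nearW. Qed.

Lemma Omega_cone x : cone (Omega Phi x).
Proof.
move=> c f c0 [[cvx usc] fmax]; split; last by move=> y; rewrite ler_pM2l.
split=> [a y z ayz|a b].
  by rewrite !ler_pM2l // => ya za; have [-> ->] := cvx a y z ayz ya za.
rewrite mulrC -ltr_pdivlMr // => /usc.
by apply: filterS => y; rewrite ltr_pdivlMr // mulrC.
Qed.

(** The threshold is the image of [d] under [t |-> t / (1 + t)], the increasing
    bijection from distances in [R] to their bounded version. *)
Lemma rho_infty_lt f g (d : R) x : 0 < d ->
  rho_infty f g < d / (1 + d) -> `|f x - g x| < d.
Proof.
move=> d0 /(le_lt_trans (rho_infty_ub f g x)).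
have := normr_ge0 (f x - g x); move: `|_| => t t0.
rewrite ltr_pdivrMr; last by lra.
rewrite mulrAC ltr_pdivlMr; last by lra.
nra.
Qed.

Lemma Omega_closed x :
  closed [set f : convex_usc_space Phi | Omega Phi x (convex_usc_fun f)].
Proof.
move=> f clf; split; first exact: (set_valP f).
move=> y; rewrite leNgt; apply/negP => xy.
(* Half the gap: changing [f x] and [f y] by less than it keeps their order. *)
pose d := (convex_usc_fun f y - convex_usc_fun f x) / 2.
have d0 : 0 < d by rewrite divr_gt0 // subr_gt0.
have e0 : 0 < d / (1 + d) by rewrite divr_gt0 //; lra.
have [g [[_ gmax]]] := clf _ (nbhsx_ballx f _ e0).
rewrite ballEmdist /= convex_usc_mdistE => fg.
have := gmax y; have := rho_infty_lt x d0 fg; have := rho_infty_lt y d0 fg.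
rewrite !ltr_norml /d; lra.
Qed.

Lemma Omega_sub_extremal x : compact [set: K] ->
  (forall phi, Phi phi -> continuous phi) -> separates_points Phi ->
  exists e, extremal Phi e /\ Omega Phi x `<=` Omega Phi e.
Proof.
move=> cK cPhi sepPhi.
pose M := \bigcap_(f in Omega Phi x) ([set: K] `&` [set a | f x <= f a]).
have [|e Me ext_e] := @closed_face_extremal _ _ _ M cK cPhi sepPhi.
  split.
  - by exists x => f _; split=> /=.
  - apply: closed_bigI => f [[_ usc] _].
    by rewrite setTI; exact: usc_closed_superlevel.
  - apply: face_bigcap => f [[cvx _] fmax].
    by apply: face_argmax => // ? *.
exists e; split=> // f Of; case: (Of) => Cf fmax; split=> // y.
by have [_ /=] := Me _ Of; apply: le_trans; exact: fmax.
Qed.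

End Omega.

Theorem corollary1 (R : realType) (K : metricType R)
    (K_nonempty : [set: K] !=set0) (K_compact : compact [set: K])
    (V : completeNormedModType R) (i : {linear V -> (K -> R^o)})
    (i_inj : injective i)
    (i_continuous : forall v : V, continuous (i v : K -> R))
    (i_separates : separates_points (range (i : V -> (K -> R))))
    (alpha : R) (alpha_gt0 : 0 < alpha)
    (sup_norm_le : forall v : V, sup_norm (i v : K -> R) <= alpha * `|v|) :
  let Phi : set (K -> R) := range (i : V -> (K -> R)) in
  forall x : K,
    Omega Phi x !=set0 /\
    closed [set f : convex_usc_space Phi | Omega Phi x (convex_usc_fun f)] /\
    cone (Omega Phi x) /\
    exists e : K, extremal Phi e /\ Omega Phi x `<=` Omega Phi e.
Proof.
move=> Phi x; split; first by exists (fun=> 0); exact: Omega_cst.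
split; first exact: Omega_closed.
split; first exact: Omega_cone.
by apply: Omega_sub_extremal => // _ [v _ <-]; exact: i_continuous.
Qed.
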